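(* Suppose a sequence of C-stationary (respectively, M-stationary) points $x^{t}\in M^{\text{D}(t)}$ of $\text{D}(t)$ with multipliers $(\zeta^t,\eta^t,\nu^t)$ converges to $\bar x$ for $t\to 0$. Let MPCC-LICQ be fulfilled at $\bar x\in M$. Then $\bar x$ is a C-stationary (respectively, M-stationary) point of MPCC.
   Context: Let $f\in C^2(\mathbb{R}^n,\mathbb{R})$, $F_1,F_2\in C^2(\mathbb{R}^n,\mathbb{R}^\kappa)$. MPCC is the problem $\min f(x)$ s.t. $x\in M$ with $M=\{x\in\mathbb{R}^n \mid F_{1,j}(x)\cdot F_{2,j}(x)=0,\ F_{1,j}(x)\ge 0,\ F_{2,j}(x)\ge 0,\ j=1,\ldots,\kappa\}$. For $t>0$, the disjunctive regularization $\text{D}(t)$ is the problem $\min f(x)$ s.t. $x\in M^{\text{D}(t)}$ with $M^{\text{D}(t)}=\{x\in\mathbb{R}^n \mid \max\{t-F_{1,j}(x),t-F_{2,j}(x)\}\ge 0,\ F_{1,j}(x)\ge 0,\ F_{2,j}(x)\ge 0,\ j=1,\ldots,\kappa\}$. In the claim, $t$ runs through positive parameters tending to $0$. MPCC notions. For $\bar x\in M$: $a_{01}(\bar x)=\{j\mid F_{1,j}(\bar x)=0,F_{2,j}(\bar x)>0\}$, $a_{10}(\bar x)=\{j\mid F_{1,j}(\bar x)>0,F_{2,j}(\bar x)=0\}$, $a_{00}(\bar x)=\{j\mid F_{1,j}(\bar x)=F_{2,j}(\bar x)=0\}$. MPCC-LICQ at $\bar x$: the vectors $\nabla F_{1,j}(\bar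 x)$, $j\in a_{01}(\bar x)\cup a_{00}(\bar x)$, and $\nabla F_{2,j}(\bar x)$, $j\in a_{10}(\bar x)\cup a_{00}(\bar x)$, are linearly independent. $\bar x\in M$ is C-stationary for MPCC if there exist multipliers $\bar\sigma_{1,j}$ ($j\in a_{01}(\bar x)$), $\bar\sigma_{2,j}$ ($j\in a_{10}(\bar x)$), $\bar\varrho_{1,j},\bar\varrho_{2,j}$ ($j\in a_{00}(\bar x)$) with $$\nabla f(\bar x)=\sum_{j\in a_{01}(\bar x)}\bar\sigma_{1,j}\nabla F_{1,j}(\bar x)+\sum_{j\in a_{10}(\bar x)}\bar\sigma_{2,j}\nabla F_{2,j}(\bar x)+\sum_{j\in a_{00}(\bar x)}\left(\bar\varrho_{1,j}\nabla F_{1,j}(\bar x)+\bar\varrho_{2,j}\nabla F_{2,j}(\bar x)\right)$$ and $\bar\varrho_{1,j}\cdot\bar\varrho_{2,j}\ge 0$ for all $j\in a_{00}(\bar x)$. It is M-stationary if, moreover, for all $j\in a_{00}(\bar x)$ either $\bar\varrho_{1,j}>0,\bar\varrho_{2,j}>0$ or $\bar\varrho_{1,j}\cdot\bar\varrho_{2,j}=0$. $\text{D}(t)$ notions. For $x\in M^{\text{D}(t)}$: $\mathcal{H}_{12}(x)=\{j\mid F_{1,j}(x)=F_{2,j}(x)=t\}$, $\mathcal{H}_{1}(x)=\{j\mid F_{1,j}(x)=t,F_{2,j}(x)>t\}$, $\mathcal{H}_{2}(x)=\{j\mid F_{1,j}(x)>t,F_{2,j}(x)=t\}$, $\mathcal{N}_1(x)=\{j\mid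 F_{1,j}(x)=0\}$, $\mathcal{N}_2(x)=\{j\mid F_{2,j}(x)=0\}$. $x\in M^{\text{D}(t)}$ is C-stationary for $\text{D}(t)$ if there exist multipliers $\zeta_{1,j},\zeta_{2,j}\ge 0$ ($j\in\mathcal{H}_{12}(x)$), $\eta_{1,j}\ge 0$ ($j\in\mathcal{H}_1(x)$), $\eta_{2,j}\ge 0$ ($j\in\mathcal{H}_2(x)$), $\nu_{1,j}\ge 0$ ($j\in\mathcal{N}_1(x)$), $\nu_{2,j}\ge 0$ ($j\in\mathcal{N}_2(x)$) with $$\nabla f(x)=-\sum_{j\in\mathcal{H}_{12}(x)}\left(\zeta_{1,j}\nabla F_{1,j}(x)+\zeta_{2,j}\nabla F_{2,j}(x)\right)-\sum_{j\in\mathcal{H}_1(x)}\eta_{1,j}\nabla F_{1,j}(x)-\sum_{j\in\mathcal{H}_2(x)}\eta_{2,j}\nabla F_{2,j}(x)+\sum_{j\in\mathcal{N}_1(x)}\nu_{1,j}\nabla F_{1,j}(x)+\sum_{j\in\mathcal{N}_2(x)}\nu_{2,j}\nabla F_{2,j}(x).$$ It is M-stationary if, moreover, $\zeta_{1,j}\cdot\zeta_{2,j}=0$ for all $j\in\mathcal{H}_{12}(x)$. *)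

(* Defs.v *)
From HB Require Import structures.
From mathcomp Require Import all_boot all_order all_algebra.
From mathcomp Require Import all_classical all_reals all_analysis.
Set Implicit Arguments.
Unset Strict Implicit.
Unset Printing Implicit Defensive.
Import Order.TTheory GRing.Theory Num.Theory.
Import numFieldNormedType.Exports.
Local Open Scope classical_set_scope.
Local Open Scope ring_scope.

(* Class C^k: all iterated partial derivatives of order at most k exist
   everywhere and are continuous. *)
Fixpoint Ck (R : realType) (n : nat) (W : normedModType R) (k : nat)
    (g : 'rV[R]_n -> W) : Prop :=
  continuous g /\
  match k with
  | 0 => True
  | k'.+1 => forall i : 'I_n,
      (forall x, derivable g x (delta_mx 0 i)) /\ Ck k' ('D_(delta_mx 0 i) g)
  end.

Definition grad (R : realType) (n : nat) (g : 'rV[R]_n -> R) (x : 'rV[R]_n) :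
  'rV[R]_n := \row_i 'D_(delta_mx 0 i) g x.

(* The gradient at x of the j-th component function of F. *)
Definition gradc (R : realType) (n m : nat) (F : 'rV[R]_n -> 'rV[R]_m)
  (j : 'I_m) (x : 'rV[R]_n) : 'rV[R]_n := grad (fun y => F y 0 j) x.

(* In all definitions of stationarity below, multipliers are total functions on
   'I_m of which only the values on the relevant index sets matter. *)

Section Problems.
Context {R : realType} {n m : nat}.
Variables (f : 'rV[R]_n -> R) (F1 F2 : 'rV[R]_n -> 'rV[R]_m).
Implicit Types (x : 'rV[R]_n) (t : R).

Definition mpcc_feasible : set 'rV[R]_n :=
  [set x | forall j, [/\ F1 x 0 j * F2 x 0 j = 0, 0 <= F1 x 0 j
                       & 0 <= F2 x 0 j]].

Definition a01 x : {set 'I_m} :=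
  [set j | (F1 x 0 j == 0) && (0 < F2 x 0 j)]%SET.
Definition a10 x : {set 'I_m} :=
  [set j | (0 < F1 x 0 j) && (F2 x 0 j == 0)]%SET.
Definition a00 x : {set 'I_m} :=
  [set j | (F1 x 0 j == 0) && (F2 x 0 j == 0)]%SET.

(* [free] is linear independence of the family (repetitions count). *)
Definition mpcc_licq x : Prop :=
  free ([seq gradc F1 j x | j in a01 x :|: a00 x] ++
        [seq gradc F2 j x | j in a10 x :|: a00 x]).

Definition mpcc_Cmultipliers x (sigma1 sigma2 rho1 rho2 : 'I_m -> R) : Prop :=
  grad f x = \sum_(j in a01 x) sigma1 j *: gradc F1 j x
           + \sum_(j in a10 x) sigma2 j *: gradc F2 j x
           + \sum_(j in a00 x) (rho1 j *: gradc F1 j x + rho2 j *: gradc F2 j x)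
  /\ (forall j, j \in a00 x -> 0 <= rho1 j * rho2 j).

Definition mpcc_Cstationary x : Prop :=
  mpcc_feasible x /\
  exists sigma1 sigma2 rho1 rho2, mpcc_Cmultipliers x sigma1 sigma2 rho1 rho2.

Definition mpcc_Mstationary x : Prop :=
  mpcc_feasible x /\
  exists sigma1 sigma2 rho1 rho2,
    mpcc_Cmultipliers x sigma1 sigma2 rho1 rho2 /\
    (forall j, j \in a00 x ->
       (0 < rho1 j /\ 0 < rho2 j) \/ rho1 j * rho2 j = 0).

Definition D_feasible t : set 'rV[R]_n :=
  [set x | forall j, [/\ 0 <= Num.max (t - F1 x 0 j) (t - F2 x 0 j),
                         0 <= F1 x 0 j & 0 <= F2 x 0 j]].

Definition H12 t x : {set 'I_m} :=
  [set j | (F1 x 0 j == t) && (F2 x 0 j == t)]%SET.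
Definition H1 t x : {set 'I_m} :=
  [set j | (F1 x 0 j == t) && (t < F2 x 0 j)]%SET.
Definition H2 t x : {set 'I_m} :=
  [set j | (t < F1 x 0 j) && (F2 x 0 j == t)]%SET.
Definition N1 x : {set 'I_m} := [set j | F1 x 0 j == 0]%SET.
Definition N2 x : {set 'I_m} := [set j | F2 x 0 j == 0]%SET.

Definition D_Cmultipliers t x
    (zeta1 zeta2 eta1 eta2 nu1 nu2 : 'I_m -> R) : Prop :=
  grad f x =
    - \sum_(j in H12 t x) (zeta1 j *: gradc F1 j x + zeta2 j *: gradc F2 j x)
    - \sum_(j in H1 t x) eta1 j *: gradc F1 j x
    - \sum_(j in H2 t x) eta2 j *: gradc F2 j x
    + \sum_(j in N1 x) nu1 j *: gradc F1 j x
    + \sum_(j in N2 x) nu2 j *: gradc F2 j x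
  /\ [/\ forall j, j \in H12 t x -> 0 <= zeta1 j /\ 0 <= zeta2 j,
         forall j, j \in H1 t x -> 0 <= eta1 j,
         forall j, j \in H2 t x -> 0 <= eta2 j,
         forall j, j \in N1 x -> 0 <= nu1 j
       & forall j, j \in N2 x -> 0 <= nu2 j].

Definition D_Cstationary t x : Prop :=
  D_feasible t x /\
  exists zeta1 zeta2 eta1 eta2 nu1 nu2,
    D_Cmultipliers t x zeta1 zeta2 eta1 eta2 nu1 nu2.

Definition D_Mstationary t x : Prop :=
  D_feasible t x /\
  exists zeta1 zeta2 eta1 eta2 nu1 nu2,
    D_Cmultipliers t x zeta1 zeta2 eta1 eta2 nu1 nu2 /\
    (forall j, j \in H12 t x -> zeta1 j * zeta2 j = 0).

End Problems.

(* Main.v *)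
(** Collect the multipliers of D(t_k) at x_k into one signed coefficient for
    each gradient of F_(1,j) and F_(2,j). Since t_k tends to 0, the coefficients
    of the components that are positive at xbar vanish for k large, so grad f(x_k)
    is a combination of gradients that converge to the independent family of
    MPCC-LICQ; hence the coefficients converge. For every k the two coefficients
    attached to j have a nonnegative product (and, under M-stationarity, are both
    nonnegative or have product 0), and these conditions are closed. *)
Require Import Defs.
From HB Require Import structures.
From mathcomp Require Import all_boot all_order all_algebra.
From mathcomp Require Import all_classical all_reals all_analysis.
Import Order.TTheory GRing.Theory Num.Theory.
Import numFieldNormedType.Exports.
Local Open Scope classical_set_scope.
Local Open Scope ring_scope.

(** * Entrywise limits of matrix products, determinants and adjugates *)

Lemma cvg_sumr {R : realType} {T I : Type} {F : set_system T} {FF : Filter F}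
    (r : seq I) (P : pred I) (u : I -> T -> R) (l : I -> R) :
  (forall i, P i -> u i x @[x --> F] --> l i) ->
  \sum_(i <- r | P i) u i x @[x --> F] --> \sum_(i <- r | P i) l i.
Proof. by apply: cvg_big; exact: add_continuous. Qed.

Lemma cvg_prodr {R : realType} {T I : Type} {F : set_system T} {FF : Filter F}
    (r : seq I) (P : pred I) (u : I -> T -> R) (l : I -> R) :
  (forall i, P i -> u i x @[x --> F] --> l i) ->
  \prod_(i <- r | P i) u i x @[x --> F] --> \prod_(i <- r | P i) l i.
Proof. by apply: cvg_big; exact: mul_continuous. Qed.

Lemma cvg_coord {R : realType} {T : Type} {F : set_system T} {FF : Filter F}
    {m n : nat} (A : T -> 'M[R]_(m, n)) (A0 : 'M[R]_(m, n)) i j :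
  A x @[x --> F] --> A0 -> A x i j @[x --> F] --> A0 i j.
Proof.
by move=> cA; exact: (cvg_comp _ _ cA (@coord_continuous R m n i j A0)).
Qed.

Lemma cvg_mulmx {R : realType} {T : Type} {F : set_system T} {FF : Filter F}
    {m n p : nat} (A : T -> 'M[R]_(m, n)) (B : T -> 'M[R]_(n, p))
    (A0 : 'M[R]_(m, n)) (B0 : 'M[R]_(n, p)) :
  (forall i j, A x i j @[x --> F] --> A0 i j) ->
  (forall i j, B x i j @[x --> F] --> B0 i j) ->
  forall i j, (A x *m B x) i j @[x --> F] --> (A0 *m B0) i j.
Proof.
move=> cA cB i j; rewrite mxE; under eq_fun do rewrite mxE.
by apply: cvg_sumr => k _; apply: cvgM.
Qed.

Lemma cvg_det {R : realType} {T : Type} {F : set_system T} {FF : Filter F}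
    {n : nat} (A : T -> 'M[R]_n) (A0 : 'M[R]_n) :
  (forall i j, A x i j @[x --> F] --> A0 i j) ->
  \det (A x) @[x --> F] --> \det A0.
Proof.
move=> cA; apply: cvg_sumr => s _; apply: cvgM; first exact: cvg_cst.
exact: cvg_prodr.
Qed.

Lemma cvg_adj {R : realType} {T : Type} {F : set_system T} {FF : Filter F}
    {n : nat} (A : T -> 'M[R]_n) (A0 : 'M[R]_n) :
  (forall i j, A x i j @[x --> F] --> A0 i j) ->
  forall i j, (\adj (A x)) i j @[x --> F] --> (\adj A0) i j.
Proof.
move=> cA i j; rewrite mxE; under eq_fun do rewrite mxE.
rewrite /cofactor; apply: cvgM; first exact: cvg_cst.
apply: (cvg_det (fun x => row' j (col' i (A x)))) => a b.
by rewrite !mxE; under eq_fun do rewrite !mxE; exact: cA.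
Qed.

(** * Convergence of the coefficients of a convergent linear combination *)

(** A right inverse [W] of [A0] makes [A x *m W] a square matrix tending to the identity, hence
    invertible near the limit; this expresses [c x] through the convergent [c x *m A x]. *)
Lemma is_cvg_row_free_coef {R : realType} {T : Type} {F : set_system T}
    {FF : ProperFilter F} {N n : nat} (A : T -> 'M[R]_(N, n))
    (A0 : 'M[R]_(N, n)) (c : T -> 'rV[R]_N) (g : 'rV[R]_n) :
  row_free A0 -> (forall i j, A x i j @[x --> F] --> A0 i j) ->
  (forall j, (c x *m A x) 0 j @[x --> F] --> g 0 j) ->
  forall i, cvg (c x 0 i @[x --> F]).
Proof.
move=> /row_freeP[W AW1] cA cg i.
have cB a b : (A x *m W) a b @[x --> F] --> (1%:M : 'M[R]_N) a b.
  by rewrite -AW1; apply: cvg_mulmx => // *; exact: cvg_cst.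
have cdet : \det (A x *m W) @[x --> F] --> (1 : R).
  by rewrite -(det1 _ N); exact: cvg_det.
(* Cramer's rule, for the square matrices [A x *m W] close to the identity. *)
pose h x := (\det (A x *m W))^-1 * (c x *m A x *m (W *m \adj (A x *m W))) 0 i.
have ch : cvg (h x @[x --> F]).
  apply/cvg_ex; eexists; apply: cvgM.
    by apply: cvgV cdet; exact: oner_neq0.
  apply: (cvg_mulmx _ _ g).
    by move=> a b; rewrite ord1.
  by apply: cvg_mulmx; [move=> *; exact: cvg_cst|exact: cvg_adj].
suff: \forall x \near F, h x = c x 0 i.
  move=> hc; have /cvg_ex[l hl] := ch; apply/cvg_ex; exists l.
  by apply: cvg_trans hl; exact: near_eq_cvg.
have dn : \forall x \near F, \det (A x *m W) != 0.
  exact: cvgr_neq0 cdet (oner_neq0 _).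
apply: filterS dn => x dx.
by rewrite /h -mulmxA (mulmxA (A x)) mul_mx_adj mul_mx_scalar mxE mulKf.
Qed.

(** Stacking the vectors as rows, one per position in [s], turns freeness into row freeness and the
    combination into a product. The index type is arbitrary so that gradients of [F1] and [F2] can
    share one family. *)
Lemma is_cvg_free_coef {R : realType} {T : Type} {F : set_system T}
    {FF : ProperFilter F} {n : nat} {I : eqType} (s : seq I)
    (v : T -> I -> 'rV[R]_n) (v0 : I -> 'rV[R]_n) (c : T -> I -> R)
    (g : 'rV[R]_n) :
  free [seq v0 p | p <- s] ->
  (forall p j, v x p 0 j @[x --> F] --> v0 p 0 j) ->
  (forall j, (\sum_(p <- s) c x p *: v x p) 0 j @[x --> F] --> g 0 j) ->
  forall p, p \in s -> cvg (c x p @[x --> F]).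
Proof.
move=> frs cv cg p ps; pose S := in_tuple s.
have mulE d w : (\row_i d (tnth S i)) *m \matrix_i w (tnth S i)
    = \sum_(q <- s) (d q : R) *: (w q : 'rV[R]_n).
  rewrite mulmx_sum_row (big_tnth _ _ s); apply: eq_bigr => i _.
  by rewrite mxE rowK.
have fr : row_free (\matrix_i v0 (tnth S i)).
  apply: inj_row_free => d d0; apply/rowP => i; rewrite [RHS]mxE.
  have /freeP := frs : free (map_tuple v0 S); apply.
  rewrite -[RHS]d0 mulmx_sum_row; apply: eq_bigr => k _.
  by rewrite rowK -tnth_nth tnth_map.
have /tnthP[i ->] : p \in S by [].
have -> : c^~ (tnth S i) = fun x => (\row_k c x (tnth S k)) 0 i.
  by apply/funext => x; rewrite mxE.
apply: (is_cvg_row_free_coef (fun x => \matrix_k v x (tnth S k)) _ _ g fr).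
- by move=> k j; rewrite mxE; under eq_fun do rewrite mxE; exact: cv.
- by move=> j; under eq_fun do rewrite mulE; exact: cg.
Qed.

(** * Continuity of gradients and signed multipliers *)

Lemma cvg_grad {R : realType} {n : nat} (g : 'rV[R]_n -> R)
    (x : nat -> 'rV[R]_n) (x0 : 'rV[R]_n) :
  Ck 2 g -> x k @[k --> \oo] --> x0 ->
  forall j, grad g (x k) 0 j @[k --> \oo] --> grad g x0 0 j.
Proof.
move=> [_ Dg] cx j; rewrite mxE; under eq_fun do rewrite mxE.
by have [_ [cD _]] := Dg j; apply: (continuous_cvg _ (cD x0)).
Qed.

Lemma cvg_gradc {R : realType} {n m : nat} (F : 'rV[R]_n -> 'rV[R]_m)
    (i : 'I_m) (x : nat -> 'rV[R]_n) (x0 : 'rV[R]_n) :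
  Ck 2 F -> x k @[k --> \oo] --> x0 ->
  forall j, gradc F i (x k) 0 j @[k --> \oo] --> gradc F i x0 0 j.
Proof.
move=> [_ DF] cx j; have [dF [cD _]] := DF j.
(* [Ck] speaks of derivatives of the vector-valued [F]; differentiation commutes with taking an
   entry. *)
have E y : gradc F i y 0 j = 'D_(delta_mx 0 j) F y 0 i.
  by rewrite derive_mx// !mxE.
rewrite E; under eq_fun do rewrite E.
have cDx : 'D_(delta_mx 0 j) F (x k) @[k --> \oo] --> 'D_(delta_mx 0 j) F x0.
  exact: (continuous_cvg _ (cD x0)).
exact: cvg_coord.
Qed.

(* The signed multipliers: l_i = nu_i on N_i, minus zeta_i on H12, minus eta_i
   on H_i, and 0 elsewhere; these index sets are disjoint because t > 0. *)
Lemma D_signed_multipliers {R : realType} {n m : nat}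
    (f : 'rV[R]_n -> R) (F1 F2 : 'rV[R]_n -> 'rV[R]_m) (t : R) (x : 'rV[R]_n)
    (zeta1 zeta2 eta1 eta2 nu1 nu2 : 'I_m -> R) :
  0 < t -> D_Cmultipliers f F1 F2 t x zeta1 zeta2 eta1 eta2 nu1 nu2 ->
  exists l1 l2 : 'I_m -> R,
    [/\ grad f x = \sum_j l1 j *: gradc F1 j x + \sum_j l2 j *: gradc F2 j x,
        forall j, t < F1 x 0 j -> l1 j = 0,
        forall j, t < F2 x 0 j -> l2 j = 0,
        forall j, 0 <= l1 j * l2 j
      & (forall j, j \in H12 F1 F2 t x -> zeta1 j * zeta2 j = 0) ->
        forall j, (0 <= l1 j /\ 0 <= l2 j) \/ l1 j * l2 j = 0].
Proof.
move=> t0 [fE [z0 e10 e20 n10 n20]].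
(* Extension by zero, so that sums over the various index sets become sums over all [j]. *)
pose b (A : {set 'I_m}) (u : 'I_m -> R) j := if j \in A then u j else 0.
pose l1 j := b (N1 F1 x) nu1 j - b (H12 F1 F2 t x) zeta1 j
  - b (H1 F1 F2 t x) eta1 j.
pose l2 j := b (N2 F2 x) nu2 j - b (H12 F1 F2 t x) zeta2 j
  - b (H2 F1 F2 t x) eta2 j.
have lE A B C u v w (G : 'I_m -> 'rV[R]_n) :
    \sum_j (b A u j - b B v j - b C w j) *: G j
    = \sum_(j in A) u j *: G j - \sum_(j in B) v j *: G j
      - \sum_(j in C) w j *: G j.
  have bE (D : {set 'I_m}) z : \sum_(j in D) z j *: G j = \sum_j b D z j *: G j.
    rewrite big_mkcond; apply: eq_bigr => j _; rewrite /b.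
    by case: ifP; rewrite ?scale0r.
  by rewrite !bE -!sumrB; apply: eq_bigr => j _; rewrite !scalerBl.
(* On [H12] the case keeps both values, since its sign comes from the [zeta]. If exactly one of the
   two components equals [t], one coefficient vanishes: a nonzero [eta] term forces the other
   component above [t], hence away from 0. If neither equals [t], only the [nu] terms remain. *)
have cases j : [\/ 0 <= l1 j /\ 0 <= l2 j,
    [/\ j \in H12 F1 F2 t x, l1 j = - zeta1 j & l2 j = - zeta2 j]
  | l1 j * l2 j = 0].
  rewrite /l1 /l2 /b.
  have := z0 j; have := n10 j; have := n20 j; rewrite !inE.
  have [-> | F1t] := eqVneq (F1 x 0 j) t.
    rewrite (gt_eqF t0) ltxx.
    have [-> | F2t] := eqVneq (F2 x 0 j) t.
      rewrite (gt_eqF t0) ltxx /= => _ _ _.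
      by rewrite !subr0 !sub0r; constructor 2.
    by rewrite /= !subr0 => *; constructor 3; case: eqP => [->|_];
      rewrite ?(lt_gtF t0) ?subr0 ?mul0r ?mulr0.
  have [-> | F2t] := eqVneq (F2 x 0 j) t.
    rewrite (gt_eqF t0) ltxx /= !subr0.
    case: (eqVneq (F1 x 0 j) 0) => [->|_] *; constructor 3.
      by rewrite (lt_gtF t0) subr0 mulr0.
    by rewrite mul0r.
  rewrite !andbF /= !subr0.
  case: (F1 x 0 j == 0) => /=; last by move=> *; constructor 3; rewrite mul0r.
  case: (F2 x 0 j == 0) => /=; last by move=> *; constructor 3; rewrite mulr0.
  by move=> /(_ isT) ? /(_ isT) ? _; constructor 1.
exists l1, l2; split.
- rewrite fE big_split /= /l1 /l2 !lE opprD.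
  (* Regroups the six sums from an ordering by [F1] and [F2] to one by kind of multiplier. *)
  by rewrite [RHS](AC (3*3) ((2*5)*3*6*1*4)).
- move=> j tF; rewrite /l1 /b !inE (gt_eqF tF) (gt_eqF (lt_trans t0 tF)).
  by rewrite /= !subr0.
- move=> j tF; rewrite /l2 /b !inE (gt_eqF tF) (gt_eqF (lt_trans t0 tF)).
  by rewrite !andbF !subr0.
- move=> j; case: (cases j) => [[]|[Hj -> ->]|->//]; first exact: mulr_ge0.
  by have [? ?] := z0 j Hj; rewrite mulrNN mulr_ge0.
- move=> zz j; case: (cases j) => [[]|[Hj -> ->]|]; [by left| |by right].
  by right; rewrite mulrNN zz.
Qed.

(** * Passage to the limit *)

Lemma mpcc_limit_multipliers {R : realType} {n m : nat}
    (f : 'rV[R]_n -> R) (F1 F2 : 'rV[R]_n -> 'rV[R]_m)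
    (t : nat -> R) (x : nat -> 'rV[R]_n) (xbar : 'rV[R]_n)
    (l1 l2 : nat -> 'I_m -> R) :
  Ck 2 f -> Ck 2 F1 -> Ck 2 F2 ->
  t k @[k --> \oo] --> (0 : R) -> x k @[k --> \oo] --> xbar ->
  mpcc_feasible F1 F2 xbar -> mpcc_licq F1 F2 xbar ->
  (forall k, grad f (x k) = \sum_j l1 k j *: gradc F1 j (x k)
                          + \sum_j l2 k j *: gradc F2 j (x k)) ->
  (forall k j, t k < F1 (x k) 0 j -> l1 k j = 0) ->
  (forall k j, t k < F2 (x k) 0 j -> l2 k j = 0) ->
  exists r1 r2 : 'I_m -> R,
    [/\ grad f xbar = \sum_(j in a01 F1 F2 xbar) r1 j *: gradc F1 j xbar
           + \sum_(j in a10 F1 F2 xbar) r2 j *: gradc F2 j xbar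
           + \sum_(j in a00 F1 F2 xbar)
               (r1 j *: gradc F1 j xbar + r2 j *: gradc F2 j xbar),
        forall j, j \in a00 F1 F2 xbar -> l1 k j @[k --> \oo] --> r1 j
      & forall j, j \in a00 F1 F2 xbar -> l2 k j @[k --> \oo] --> r2 j].
Proof.
move=> Cf CF1 CF2 ct cx feas licq fE l1_0 l2_0.
set A1 := a01 F1 F2 xbar :|: a00 F1 F2 xbar.
set A2 := a10 F1 F2 xbar :|: a00 F1 F2 xbar.
(* [F (x k) 0 j - t k] tends to a positive number, so it is eventually positive; finiteness of
   ['I_m] makes this uniform in [j]. *)
have inactive (F : 'rV[R]_n -> 'rV[R]_m) (l : nat -> 'I_m -> R) (A : {set 'I_m}) : Ck 2 F ->
    (forall k j, t k < F (x k) 0 j -> l k j = 0) ->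
    (forall j, j \notin A -> 0 < F xbar 0 j) ->
    \forall k \near \oo, forall j, j \notin A -> l k j = 0.
  move=> [cF _] l0 FA; apply: filter_forall => j.
  have [jA|jA] := boolP (j \in A); first by apply: nearW.
  have cFj : F (x k) 0 j - t k @[k --> \oo] --> F xbar 0 j - 0.
    apply: cvgB ct.
    apply: cvg_coord; exact: (continuous_cvg _ (cF xbar)).
  have : \forall k \near \oo, 0 < F (x k) 0 j - t k.
    by apply: (cvgr_gt _ cFj); rewrite subr0; exact: FA.
  by apply: filterS => k; rewrite subr_gt0 => /l0.
have near1 : \forall k \near \oo, forall j, j \notin A1 -> l1 k j = 0.
  apply: (inactive F1) => // j; have [_ F1ge F2ge] := feas j.
  rewrite !inE !lt_def F1ge F2ge !andbT.
  by case: (F1 xbar 0 j == 0); case: (F2 xbar 0 j == 0).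
have near2 : \forall k \near \oo, forall j, j \notin A2 -> l2 k j = 0.
  apply: (inactive F2) => // j; have [_ F1ge F2ge] := feas j.
  rewrite !inE !lt_def F1ge F2ge !andbT.
  by case: (F1 xbar 0 j == 0); case: (F2 xbar 0 j == 0).
(* The sum type keeps apart the two gradients of a biactive index; [s] follows the order of the
   family in [mpcc_licq]. *)
pose G y p := match p with inl j => gradc F1 j y | inr j => gradc F2 j y end.
pose l k p := match p with inl j => l1 k j | inr j => l2 k j end.
pose s : seq ('I_m + 'I_m) := map inl (enum A1) ++ map inr (enum A2).
have sumE (c1 c2 : 'I_m -> R) (g1 g2 : 'I_m -> 'rV[R]_n) :
    \sum_(p <- s) (match p with inl j => c1 j | inr j => c2 j end)
              *: (match p with inl j => g1 j | inr j => g2 j end)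
    = \sum_(j in A1) c1 j *: g1 j + \sum_(j in A2) c2 j *: g2 j.
  by rewrite big_cat !big_map !big_enum.
have cG p j : G (x k) p 0 j @[k --> \oo] --> G xbar p 0 j.
  by case: p => i; exact: cvg_gradc.
have cs j : (\sum_(p <- s) l k p *: G (x k) p) 0 j @[k --> \oo]
    --> grad f xbar 0 j.
  apply: cvg_trans (cvg_grad _ _ _ Cf cx j); apply: near_eq_cvg.
  near=> k; rewrite fE sumE; congr fun_of_matrix; congr +%R.
    rewrite [RHS]big_mkcond; apply: eq_bigr => i _.
    by case: ifPn => // iA; rewrite (near near1 k)// scale0r.
  rewrite [RHS]big_mkcond; apply: eq_bigr => i _.
  by case: ifPn => // iA; rewrite (near near2 k)// scale0r.
have cl p : p \in s -> cvg (l k p @[k --> \oo]).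
  apply: (is_cvg_free_coef _ _ _ _ _ _ cG cs).
  by rewrite map_cat -!map_comp.
pose r1 j := lim (l1 k j @[k --> \oo]); pose r2 j := lim (l2 k j @[k --> \oo]).
have cl1 j : j \in A1 -> l1 k j @[k --> \oo] --> r1 j.
  move=> jA; apply: (cl (inl j)).
  by rewrite mem_cat map_f // mem_enum.
have cl2 j : j \in A2 -> l2 k j @[k --> \oo] --> r2 j.
  move=> jA; apply: (cl (inr j)).
  by rewrite mem_cat orbC map_f // mem_enum.
exists r1, r2; split; last 2 first.
- by move=> j j00; apply: cl1; rewrite inE j00 orbT.
- by move=> j j00; apply: cl2; rewrite inE j00 orbT.
have -> : grad f xbar = \sum_(j in A1) r1 j *: gradc F1 j xbar
                      + \sum_(j in A2) r2 j *: gradc F2 j xbar.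
  apply/rowP => j; apply: (cvg_unique _ (cs j)) => //=.
  (* [big_seq] records [p \in s], which [cl] requires. *)
  rewrite -sumE summxE big_seq; under eq_cvg do rewrite summxE big_seq.
  apply: cvg_sumr => p ps; rewrite mxE; under eq_fun do rewrite mxE.
  by apply: cvgM (cG p j); case: p ps => i /cl.
(* Disjointness lets the sums over [A1] and [A2] split, and the two [a00] parts are then merged. *)
have disj1 : [disjoint a01 F1 F2 xbar & a00 F1 F2 xbar]%B.
  apply/pred0P => j /=; rewrite !inE lt_def.
  by case: (F2 xbar 0 j == 0); rewrite /= ?andbF.
have disj2 : [disjoint a10 F1 F2 xbar & a00 F1 F2 xbar]%B.
  apply/pred0P => j /=; rewrite !inE lt_def.
  by case: (F1 xbar 0 j == 0); rewrite /= ?andbF.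
rewrite big_split /= addrACA -!bigU//; congr (_ + _); apply: eq_bigl => j;
  by rewrite !inE.
Unshelve. all: by end_near. Qed.

Theorem theorem2 (R : realType) (n m : nat)
  (f : 'rV[R]_n -> R) (F1 F2 : 'rV[R]_n -> 'rV[R]_m)
  (hf : Ck 2 f) (hF1 : Ck 2 F1) (hF2 : Ck 2 F2)
  (t : nat -> R) (ht : forall k, 0 < t k) (ht0 : t k @[k --> \oo] --> (0 : R))
  (x : nat -> 'rV[R]_n) (xbar : 'rV[R]_n)
  (hx : x k @[k --> \oo] --> xbar)
  (hxbar : mpcc_feasible F1 F2 xbar) (hlicq : mpcc_licq F1 F2 xbar) :
  ((forall k, D_Cstationary f F1 F2 (t k) (x k)) ->
     mpcc_Cstationary f F1 F2 xbar) /\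
  ((forall k, D_Mstationary f F1 F2 (t k) (x k)) ->
     mpcc_Mstationary f F1 F2 xbar).
Proof.
(* [P] is the sign condition on each coefficient pair, instantiated once per kind of stationarity.
   The same [r1], [r2] serve as [sigma] and [rho], whose index sets are disjoint. The sequences [u],
   [v] are kept because M-stationarity needs more than the sign of the limit product. *)
have limits (P : R -> R -> Prop) :
    (forall k, exists l1 l2 : 'I_m -> R,
      [/\ grad f (x k) = \sum_j l1 j *: gradc F1 j (x k)
                       + \sum_j l2 j *: gradc F2 j (x k),
          forall j, t k < F1 (x k) 0 j -> l1 j = 0,
          forall j, t k < F2 (x k) 0 j -> l2 j = 0
        & forall j, P (l1 j) (l2 j)]) ->
    (forall (u v : nat -> R) (a b : R), u k @[k --> \oo] --> a ->
       v k @[k --> \oo] --> b -> (forall k, P (u k) (v k)) -> 0 <= a * b) ->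
    exists r1 r2, mpcc_Cmultipliers f F1 F2 xbar r1 r2 r1 r2 /\
      forall j, j \in a00 F1 F2 xbar -> exists u v : nat -> R,
        [/\ u k @[k --> \oo] --> r1 j, v k @[k --> \oo] --> r2 j
          & forall k, P (u k) (v k)].
  move=> /choice[l1 /choice[l2 lP]] P_ge0.
  have [|k j|k j|r1 [r2 [fE c1 c2]]] := mpcc_limit_multipliers
      f F1 F2 t x xbar l1 l2 hf hF1 hF2 ht0 hx hxbar hlicq.
  - by move=> k; case: (lP k).
  - by case: (lP k) => _ + _ _; apply.
  - by case: (lP k) => _ _ + _; apply.
  have seqs j (j00 : j \in a00 F1 F2 xbar) : exists u v : nat -> R,
      [/\ u k @[k --> \oo] --> r1 j, v k @[k --> \oo] --> r2 j
        & forall k, P (u k) (v k)].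
    exists (l1^~ j), (l2^~ j).
    by split=> [||k]; [exact: c1|exact: c2|case: (lP k)].
  exists r1, r2; split=> //; split=> // j /seqs[u [v [ur vr Puv]]].
  exact: P_ge0 ur vr Puv.
have prod_ge0 (u v : nat -> R) (a b : R) : u k @[k --> \oo] --> a ->
    v k @[k --> \oo] --> b -> (forall k, 0 <= u k * v k) -> 0 <= a * b.
  by move=> ua vb uv; apply: (cvgr_to_ge (cvgM ua vb)); exact: nearW.
(* Non-strict inequalities, because strict ones can be lost in the limit; strictness is recovered
   below from a nonzero limit product. *)
pose M (a b : R) := (0 <= a /\ 0 <= b) \/ a * b = 0.
have M_ge0 a b : M a b -> 0 <= a * b.
  by move=> [[a0 b0]|->//]; exact: mulr_ge0.
split=> st.
- have [k|u v a b ua vb|r1 [r2 [mult _]]] := limits (fun a b => 0 <= a * b).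
  + have [_ [z1 [z2 [e1 [e2 [n1 [n2 mult]]]]]]] := st k.
    have [l1 [l2 [? ? ? ? _]]] :=
      D_signed_multipliers _ _ _ _ _ _ _ _ _ _ _ (ht k) mult.
    by exists l1, l2.
  + exact: prod_ge0 ua vb.
  by split=> //; exists r1, r2, r1, r2.
- have [k|u v a b ua vb Muv|r1 [r2 [mult seqs]]] := limits M.
  + have [_ [z1 [z2 [e1 [e2 [n1 [n2 [mult zz]]]]]]]] := st k.
    have [l1 [l2 [? ? ? _ /(_ zz) ?]]] :=
      D_signed_multipliers _ _ _ _ _ _ _ _ _ _ _ (ht k) mult.
    by exists l1, l2.
  + by apply: prod_ge0 ua vb _ => k; exact: M_ge0.
  split=> //; exists r1, r2, r1, r2; split=> // j j00.
  have [r0|r_neq0] := eqVneq (r1 j * r2 j) 0; first by right.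
  left; have r_gt0 : 0 < r1 j * r2 j by rewrite lt_def r_neq0 mult.2.
  have [u [v [ur vr Muv]]] := seqs j j00.
  (* If both limits were negative, so would be both sequences eventually,
     which M excludes. *)
  have [r1_gt0|r1_lt0|r1_0] := ltgtP 0 (r1 j).
  + by split=> //; rewrite -(pmulr_rgt0 _ r1_gt0).
  + have r2_lt0 : r2 j < 0 by rewrite -(nmulr_rgt0 _ r1_lt0).
    have [k [u_lt0 v_lt0]] : exists k, u k < 0 /\ v k < 0.
      apply: (@filter_ex _ \oo); near=> k; split; near: k.
        exact: cvgr_lt ur _ r1_lt0.
      exact: cvgr_lt vr _ r2_lt0.
    have [[]|/eqP] := Muv k; first by rewrite leNgt u_lt0.
    by rewrite mulf_eq0 !lt_eqF.
  + by move: r_neq0; rewrite -r1_0 mul0r eqxx.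
Unshelve. all: by end_near. Qed.
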